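(* Let $V$ be a vertex ring with canonical Hasse--Schmidt derivation $\underline{D}=(\mathrm{Id}_V,D_1,D_2,\dots)$, and let $u\in V$. Then the following are equivalent: (a) $u\in C(V)$, where $C(V)$ is the center of $V$; (b) $D_i u=0$ for all $i\ge 1$.
   Context: A vertex ring is an additive abelian group $V$ with biadditive products $u(n)v$ for all $n\in\mathbf{Z}$ and a distinguished element $\mathbf{1}\in V$ (the vacuum) such that for all $u,v,w\in V$: (a) there is an integer $n_0(u,v)\ge 0$ with $u(n)v=0$ for all $n\ge n_0$; (b) $u(-1)\mathbf{1}=u$ and $u(n)\mathbf{1}=0$ for $n\ge 0$; (c) for all $r,s,t\in\mathbf{Z}$, $\sum_{i\ge 0}\binom{r}{i}(u(t+i)v)(r+s-i)w=\sum_{i\ge 0}(-1)^i\binom{t}{i}\{u(r+t-i)v(s+i)w-(-1)^t v(s+t-i)u(r+i)w\}$. Here $\binom{m}{n}=m(m-1)\cdots(m-n+1)/n!$ for $m\in\mathbf{Z}$, $n\ge 1$, and $\binom{m}{0}=1$. The canonical Hasse--Schmidt derivation of $V$ is the sequence of endomorphisms $D_m(u):=u(-m-1)\mathbf{1}$, $m\ge 0$. The center $C(V)$ is the set of all $u\in V$ with $Y(u,z):=\sum_n u(n)z^{-n-1}=u(-1)$, i.e. such that $u(n)v=0$ for all $v\in V$ and all $n\ne -1$. *)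

(* Defs.v *)
From HB Require Import structures.
From mathcomp Require Import all_boot all_order all_algebra.
From mathcomp Require Import boolp classical_sets fsbigop.

Set Implicit Arguments.
Unset Strict Implicit.
Unset Printing Implicit Defensive.

Import Order.TTheory GRing.Theory Num.Theory.
Local Open Scope classical_set_scope.
Local Open Scope ring_scope.

(* The division is exact: see [binzK]. *)
Definition binz (m : int) (n : nat) : int :=
  ((\prod_(j < n) (m - j%:Z)) %/ (n`!)%:Z)%Z.

Lemma dvdz_fact_prod (m : int) (n : nat) :
  ((n`!)%:Z %| \prod_(j < n) (m - j%:Z))%Z.
Proof.
case: m => m.
  have [mn|nm] := ltnP m n.
    by rewrite (bigD1 (Ordinal mn)) //= subrr mul0r dvdz0.
  have -> : \prod_(j < n) (m%:Z - j%:Z) = (m ^_ n)%:Z.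
    rewrite ffact_prod (big_morph Posz PoszM (erefl 1%:Z)).
    by apply: eq_bigr => j _; rewrite subzn // (leq_trans (ltnW (ltn_ord j))).
  by rewrite -bin_ffact PoszM dvdz_mull.
have -> : \prod_(j < n) (Negz m - j%:Z) = (-1) ^+ n * ((m + n) ^_ n)%:Z.
  rewrite ffact_prod (big_morph Posz PoszM (erefl 1%:Z)).
  rewrite [in RHS](reindex_inj rev_ord_inj) /=.
  rewrite -[in (-1) ^+ n](card_ord n) -prodr_const -big_split /=.
  apply: eq_bigr => j _; rewrite NegzE mulN1r -opprD -PoszD; congr (- Posz _).
  by rewrite subnBA ?ltn_ord // addnAC addnK addnS addSn.
by rewrite -bin_ffact PoszM dvdz_mull // dvdz_mull.
Qed.

Lemma binzK (m : int) (n : nat) :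
  binz m n * (n`!)%:Z = \prod_(j < n) (m - j%:Z).
Proof. by rewrite divzK // dvdz_fact_prod. Qed.

(* [mode u n v] is the product u(n)v.  In the last axiom the sums over
   [i >= 0] are the finitely supported sums of [fsbigop], which are set to 0 on
   an infinite support; [mode_truncation] makes all the supports finite. *)
HB.mixin Record isVertexRing V of GRing.Zmodule V := {
  mode : V -> int -> V -> V;
  vacuum : V;
  modeDl : forall (n : int) (u u' v : V),
    mode (u + u') n v = mode u n v + mode u' n v;
  modeDr : forall (n : int) (u v v' : V),
    mode u n (v + v') = mode u n v + mode u n v';
  mode_truncation : forall u v : V,
    exists n0 : nat, forall n : int, n0%:Z <= n -> mode u n v = 0;
  mode_vacuumN1 : forall u : V, mode u (-1) vacuum = u;
  mode_vacuum_ge0 : forall (u : V) (n : int), 0 <= n -> mode u n vacuum = 0;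
  mode_jacobi : forall (u v w : V) (r s t : int),
    \sum_(i \in [set: nat])
      mode (mode u (t + i%:Z) v) (r + s - i%:Z) w *~ binz r i
    = \sum_(i \in [set: nat])
      (mode u (r + t - i%:Z) (mode v (s + i%:Z) w)
       - mode v (s + t - i%:Z) (mode u (r + i%:Z) w) *~ ((-1) ^ t))
      *~ ((-1) ^+ i * binz t i)
}.

#[short(type="vertexRingType")]
HB.structure Definition VertexRing := {V of isVertexRing V & GRing.Zmodule V}.

Arguments vacuum {V} : rename.
Arguments mode_jacobi {V} u v w r s t : rename.

Definition hasse_schmidt (V : vertexRingType) (m : nat) (u : V) : V :=
  mode u (- m%:Z - 1) vacuum.

Lemma hasse_schmidt_is_additive (V : vertexRingType) (m : nat) :
  zmod_morphism (@hasse_schmidt V m).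
Proof.
move=> u v; apply: (addIr (hasse_schmidt m v)).
by rewrite subrK /hasse_schmidt -modeDl subrK.
Qed.

HB.instance Definition _ (V : vertexRingType) (m : nat) :=
  GRing.isZmodMorphism.Build V V (@hasse_schmidt V m)
    (hasse_schmidt_is_additive m).

Lemma hasse_schmidt0 (V : vertexRingType) (u : V) : hasse_schmidt 0 u = u.
Proof. by rewrite /hasse_schmidt oppr0 add0r mode_vacuumN1. Qed.

Definition center (V : vertexRingType) : set V :=
  [set u : V | forall (v : V) (n : int), n != -1 -> mode u n v = 0].
Arguments center V _ : clear implicits.

(* Main.v *)
Require Import Defs.
From HB Require Import structures.
From mathcomp Require Import all_boot all_order all_algebra.
From mathcomp Require Import boolp classical_sets fsbigop.
From mathcomp Require Import zify.

(** The Jacobi identity for [u], [vacuum], [w] with [r = 0] computes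
    [(D_i u)(s)] as an integral multiple of [u(s - i)].  If all the [D_i u] with
    [i >= 1] vanish, then [s = -1] kills the modes [u(m)] with [m < -1], while
    for [m >= 0] it gives ['C(m + i, m) u(m) = 0] for every [i >= 1].  Finite
    differences in [i] turn these relations into [u(m) = 0]. *)

Set Implicit Arguments.
Unset Strict Implicit.
Unset Printing Implicit Defensive.

Import GRing.Theory.
Local Open Scope classical_set_scope.
Local Open Scope ring_scope.

Lemma binz_n0 (m : int) : binz m 0 = 1.
Proof. by rewrite /binz big_ord0 fact0 divz1. Qed.

Lemma binz_0n (n : nat) : binz 0 n = (n == 0%N)%:Z.
Proof.
case: n => [|n]; first by rewrite binz_n0.
by rewrite /binz big_ord_recl subrr mul0r div0z.
Qed.

Lemma binz_Negz (k n : nat) : binz (Negz k) n = (-1) ^+ n * 'C(k + n, n)%:Z.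
Proof.
have fn0 : (n`!)%:Z != 0 by rewrite eqz_nat -lt0n fact_gt0.
apply: (mulIf fn0); rewrite binzK -mulrA -PoszM bin_ffact ffact_prod.
rewrite (big_morph Posz PoszM (erefl 1%:Z)).
(* Reversal pairs the factor [-(k+1) - j] with [k + 1 + j], one sign per factor. *)
rewrite [in RHS](reindex_inj rev_ord_inj) /=.
rewrite -[in (-1) ^+ n](card_ord n) -prodr_const -big_split /=.
by apply: eq_bigr => j _; have := ltn_ord j; lia.
Qed.

Lemma signr_binz_Negz (k n : nat) :
  (-1) ^+ n * binz (Negz k) n = 'C(k + n, n)%:Z.
Proof. by rewrite binz_Negz mulrA -expr2 sqrr_sign mul1r. Qed.

Lemma fsum_ord (V : zmodType) (n : nat) (F : nat -> V) :
    (forall i, (n <= i)%N -> F i = 0) ->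
  \sum_(i \in [set: nat]) F i = \sum_(i < n) F i.
Proof.
move=> F0; rewrite fsbig_ord; apply/esym/fsbig_widen => // i [_ /= /negP].
by rewrite -leqNgt => /F0.
Qed.

Lemma fsum1 (V : zmodType) (j : nat) (F : nat -> V) :
    (forall i, i != j -> F i = 0) ->
  \sum_(i \in [set: nat]) F i = F j.
Proof.
move=> F0; rewrite -[RHS](fsbig_set1 +%R j F); apply/esym/fsbig_widen => // i [_ /= ij].
by apply: F0; apply/eqP.
Qed.

(** By Pascal's rule, subtracting the relations at [i] and [i + 1] lowers [m] by one, down to
    ['C(i, 0) = 1]. As [V] may have torsion, a single relation would not suffice. *)
Lemma bin_annihilator (V : zmodType) (m : nat) (x : V) (N : nat) :
  (forall i : nat, (N <= i)%N -> x *+ 'C(i, m) = 0) -> x = 0.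
Proof.
elim: m => [/(_ N (leqnn N))|m IH xC]; first by rewrite bin0.
apply: IH => i Ni; have := xC i.+1 (leqW Ni).
by rewrite binS mulrnDr xC // add0r.
Qed.

Section VertexRing.
Variable V : vertexRingType.
Implicit Types (u v w : V) (n r s t : int).

Lemma mode0l n v : mode (0 : V) n v = 0.
Proof. by apply: (addrI (mode 0 n v)); rewrite -modeDl !addr0. Qed.

Lemma mode0r u n : mode u n 0 = 0.
Proof. by apply: (addrI (mode u n 0)); rewrite -modeDr !addr0. Qed.

(** In the Jacobi identity with [v = vacuum] and [t = 0], the left side vanishes because [u(i)1 = 0]
    for [i >= 0], and the right side reduces to the commutator. *)
Lemma mode_vacuum_comm u w r s :
  mode u r (mode vacuum s w) = mode vacuum s (mode u r w).
Proof.
have := mode_jacobi u vacuum w r s 0.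
rewrite (@fsum1 _ 0%N); last first.
  by move=> i _; rewrite mode_vacuum_ge0 ?mode0l ?mul0rz //; lia.
rewrite (@fsum1 _ 0%N); last first.
  by move=> i /negPf i0; rewrite binz_0n i0 mulr0 mulr0z.
rewrite mode_vacuum_ge0 // mode0l mul0rz binz_n0 expr0 mulr1 expr0z !mulr1z.
by rewrite !subr0 => /esym/eqP; rewrite subr_eq0 => /eqP.
Qed.

Lemma mode_assoc u v w s t :
  mode (mode u t v) s w = \sum_(i \in [set: nat])
    (mode u (t - i%:Z) (mode v (s + i%:Z) w)
     - mode v (s + t - i%:Z) (mode u i%:Z w) *~ ((-1) ^ t))
    *~ ((-1) ^+ i * binz t i).
Proof.
have := mode_jacobi u v w 0 s t.
rewrite (@fsum1 _ 0%N); last first.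
  by move=> i /negPf i0; rewrite binz_0n i0 mulr0z.
rewrite binz_0n mulr1z addr0 subr0 add0r => ->.
by under [in LHS]eq_fsbigr => i _ do rewrite !add0r.
Qed.

(* [(1(-1)1)(-m-1)1] expands into the sum of the [1(-1-i)1(-m-1+i)1] with
   [0 <= i <= m]; both extreme terms equal [D_m 1] and the others vanish by
   induction, so that [D_m 1 = 2 D_m 1]. *)
Lemma hasse_schmidt_vacuum (m : nat) :
  (0 < m)%N -> hasse_schmidt m (vacuum : V) = 0.
Proof.
elim/ltn_ind: m => [[//|m]] IH _.
have := mode_assoc vacuum vacuum vacuum (- m.+1%:Z - 1) (-1).
rewrite mode_vacuumN1 (@fsum_ord _ m.+2); last first.
  by move=> i mi; rewrite !mode_vacuum_ge0 ?mode0r ?mul0rz ?subr0 ?mul0rz //; lia.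
rewrite big_ord_recl big_ord_recr big1 /=; last first.
  move=> i _; rewrite [mode vacuum _%:Z _]mode_vacuum_ge0 // mode0r mul0rz subr0.
  have -> : - m.+1%:Z - 1 + (bump 0 i)%:Z = - (m - i)%N%:Z - 1.
    by have := ltn_ord i; rewrite /bump; lia.
  rewrite -/(hasse_schmidt (m - i) vacuum) IH ?mode0r ?mul0rz //.
    by have := ltn_ord i; lia.
  by have := ltn_ord i; lia.
rewrite !(@mode_vacuum_ge0 _ _ (Posz _)) // !mode0r !mul0rz !subr0 add0r.
(* [1(-1)] is not yet known to be the identity on [V]; commuting the two modes in the [i = 0] term
   lets it act on the vacuum itself. *)
rewrite mode_vacuum_comm mode_vacuumN1 binz_n0 expr0 mulr1 mulr1z /bump /= add1n.
rewrite (signr_binz_Negz 0) add0n binn mulr1z.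
rewrite [X in mode _ _ (mode _ X _)](_ : _ = -1); last by lia.
rewrite mode_vacuumN1 (_ : -1 - m.+1%:Z = - m.+1%:Z - 1); last by lia.
move=> /(congr1 (fun x => x - mode vacuum (- m.+1%:Z - 1) vacuum)).
by rewrite addrK subrr => /esym.
Qed.

Lemma mode_vacuuml_vacuum n : n != -1 -> mode vacuum n (vacuum : V) = 0.
Proof.
case: n => n n1; first exact: mode_vacuum_ge0.
rewrite -(@hasse_schmidt_vacuum n); last by lia.
by rewrite /hasse_schmidt; congr mode; lia.
Qed.

(** Writing [w = w(-1)1] and commuting gives [1(n)w = w(-1)1(n)1], so the vacuum vector decides. *)
Lemma mode_vacuuml n w : mode vacuum n w = if n == -1 then w else 0.
Proof.
rewrite -[in LHS](mode_vacuumN1 w) -mode_vacuum_comm.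
case: eqP => [->|/eqP n1]; first by rewrite !mode_vacuumN1.
by rewrite mode_vacuuml_vacuum // mode0r.
Qed.

Lemma mode_hasse_schmidtN1 (i : nat) u w :
  mode (hasse_schmidt i u) (-1) w = mode u (- i%:Z - 1) w.
Proof.
(* The vacuum modes that occur are [1(-1 + j)] and [1(-i - 2 - j)]; only the first can be [1(-1)],
   at [j = 0]. *)
rewrite mode_assoc (@fsum1 _ 0%N) => [|j j0].
  rewrite !mode_vacuuml !addr0 eqxx ifF; last by lia.
  by rewrite mul0rz subr0 binz_n0 mulr1z.
rewrite !mode_vacuuml !ifF ?mode0r ?mul0rz ?subr0 ?mul0rz //; lia.
Qed.

Lemma mode_hasse_schmidtD (i m : nat) u w :
  mode (hasse_schmidt i u) (i + m)%N%:Z w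
    = mode u m%:Z w *+ 'C(i + m, m) *~ (-1) ^+ i.
Proof.
(* Now they are [1(i + m + j)] and [1(m - 1 - j)]; only the second can be [1(-1)], at [j = m]. *)
rewrite mode_assoc (@fsum1 _ m) => [|j jm].
  rewrite !mode_vacuuml ifT; last by lia.
  rewrite (_ : ((i + m)%N%:Z + m%:Z == -1) = false) ?mode0r; last by lia.
  rewrite (_ : - i%:Z - 1 = Negz i); last by lia.
  rewrite signr_binz_Negz sub0r.
  (* The remaining sign is [-(-1)^(-i-1) = (-1)^i]. *)
  rewrite -mulrNz NegzE -exprnN invr_sign exprS mulN1r opprK -!mulrzA mulrC.
  by rewrite pmulrn -mulrzA.
rewrite !mode_vacuuml !ifF ?mode0r ?mul0rz ?subr0 ?mul0rz //; lia.
Qed.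

End VertexRing.

Theorem theorem6p3 (V : vertexRingType) (u : V) :
  u \in center V <-> (forall i : nat, (1 <= i)%N -> hasse_schmidt i u = 0%R).
Proof.
rewrite in_setE; split=> [uC i i_gt0|Du0 v n].
  by apply: uC; lia.
case: n => [m _|[//|k] _].
  (* The bound [m + 1] makes [i - m >= 1], so that [D_(i-m) u = 0] applies. *)
  apply: (@bin_annihilator _ m _ m.+1) => i mi.
  have := mode_hasse_schmidtD (i - m) m u v.
  rewrite Du0 ?subn_gt0 // mode0l subnK; last exact: ltnW.
  move=> /(congr1 (fun y => y *~ (-1) ^+ (i - m))).
  by rewrite mul0rz -mulrzA -expr2 sqrr_sign mulr1z => /esym.
(* Here [n = -(k+1) - 1], the value [-1] having been excluded. *)
have := mode_hasse_schmidtN1 k.+1 u v; rewrite Du0 // mode0l => /esym <-.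
by congr mode; lia.
Qed.
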